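(* Let $\mathbf{C}$ be a locally small category, $T : \mathbf{C} \to \mathbf{C}$ a functor and $\mu : TT \to T$ a multiplication for $T$. Let $\mathbf{W}$ be a category whose objects are weak Eilenberg-Moore $T$-algebras, whose morphisms are the algebraic homomorphisms, and in which the composition of morphisms is as in $\mathbf{C}$. If $\mathbf{C}$ has the dual Ramsey property then so does every full subcategory of $\mathbf{W}$ which contains all the free Eilenberg-Moore $T$-algebras.
   Context: A multiplication for a functor $T:\mathbf{C}\to\mathbf{C}$ is a natural transformation $\mu:TT\to T$ such that $\mu_A\cdot T(\mu_A)=\mu_A\cdot\mu_{T(A)}$ for every object $A$ (no unit is assumed). A $T$-algebra is a pair $(A,\alpha)$ with $\alpha\in\hom_{\mathbf{C}}(T(A),A)$. A weak Eilenberg-Moore $T$-algebra is a $T$-algebra $(A,\alpha)$ such that $\alpha\cdot T(\alpha)=\alpha\cdot\mu_A$. An algebraic homomorphism $(A,\alpha)\to(B,\beta)$ is a morphism $f\in\hom_{\mathbf{C}}(A,B)$ with $f\cdot\alpha=\beta\cdot T(f)$. A free Eilenberg-Moore $T$-algebra is one of the form $(T(A),\mu_A)$, $A\in\mathrm{Ob}(\mathbf{C})$. A locally small category $\mathbf{C}$ has the dual Ramsey property if for every integer $k\ge 2$ and all objects $A,B$ of $\mathbf{C}$ there is an object $C$ of $\mathbf{C}$ such that for every coloring $\chi:\hom_{\mathbf{C}}(C,A)\to\{0,\dots,k-1\}$ there is a morphism $w\in\hom_{\mathbf{C}}(C,B)$ with $|\chi(\{f\cdot w:f\in\hom_{\mathbf{C}}(B,A)\})|\le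 1$. *)

(* Defs.v *)
From mathcomp Require Import all_boot.
From mathcomp Require Import boolp classical_sets functions cardinality.

Set Implicit Arguments.
Unset Strict Implicit.
Unset Printing Implicit Defensive.

Local Open Scope classical_set_scope.
Local Open Scope card_scope.

(* Local smallness is built in: objects form a type of arbitrary size, while
   each [hom A B] is a type of its own, compared with Leibniz equality.
   [mcomp f g] is f . g, i.e. f after g. *)
Record category := Category {
  ob :> Type;
  hom : ob -> ob -> Type;
  idm : forall A, hom A A;
  mcomp : forall A B D, hom B D -> hom A B -> hom A D;
  mcompA : forall A B D E (f : hom D E) (g : hom B D) (h : hom A B),
    mcomp f (mcomp g h) = mcomp (mcomp f g) h;
  mcomp1m : forall A B (f : hom A B), mcomp (idm B) f = f;
  mcompm1 : forall A B (f : hom A B), mcomp f (idm A) = f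
}.
Arguments idm {c} A.

Notation "f ∘ g" := (mcomp f g) (at level 40, left associativity).

Record functor (C D : category) := Functor {
  fob :> C -> D;
  fmap : forall A B, hom A B -> hom (fob A) (fob B);
  fmap_id : forall A, fmap (idm A) = idm (fob A);
  fmap_comp : forall A B E (f : hom B E) (g : hom A B),
    fmap (f ∘ g) = fmap f ∘ fmap g
}.
Arguments fmap {C D} T {A B} f : rename.

Section FunctorComposition.
Variables (C D E : category) (G : functor D E) (F : functor C D).

Lemma functor_comp_id (A : C) : fmap G (fmap F (idm A)) = idm (G (F A)).
Proof. by rewrite !fmap_id. Qed.

Lemma functor_comp_comp (A B X : C) (f : hom B X) (g : hom A B) :
  fmap G (fmap F (f ∘ g)) = fmap G (fmap F f) ∘ fmap G (fmap F g).
Proof. by rewrite !fmap_comp. Qed.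

Definition functor_comp : functor C E :=
  @Functor C E (fun A => G (F A)) (fun A B f => fmap G (fmap F f))
    functor_comp_id functor_comp_comp.
End FunctorComposition.

Record nat_trans (C D : category) (F G : functor C D) := NatTrans {
  component :> forall A : C, hom (F A) (G A);
  naturality : forall (A B : C) (f : hom A B),
    component B ∘ fmap F f = fmap G f ∘ component A
}.

Record multiplication (C : category) (T : functor C C) := Multiplication {
  mult :> nat_trans (functor_comp T T) T;
  multA : forall A : C, mult A ∘ fmap T (mult A) = mult A ∘ mult (T A)
}.

Record algebra (C : category) (T : functor C C) := Algebra {
  carrier : C;
  structure : hom (T carrier) carrier
}.

Definition weak_EM (C : category) (T : functor C C) (mu : multiplication T)
    (X : algebra T) : Prop :=
  structure X ∘ fmap T (structure X) = structure X ∘ mu (carrier X).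

Definition free_EM (C : category) (T : functor C C) (mu : multiplication T)
    (A : C) : algebra T :=
  @Algebra C T (T A) (mu A).

Section AlgebraCategory.
Variables (C : category) (T : functor C C).
Implicit Types X Y Z : algebra T.

Definition is_alg_hom X Y (f : hom (carrier X) (carrier Y)) : Prop :=
  f ∘ structure X = structure Y ∘ fmap T f.

Definition alg_hom X Y : Type :=
  {f : hom (carrier X) (carrier Y) | is_alg_hom f}.

Lemma is_alg_hom_id X : @is_alg_hom X X (idm (carrier X)).
Proof. by rewrite /is_alg_hom fmap_id mcomp1m mcompm1. Qed.

Lemma is_alg_hom_comp X Y Z (f : hom (carrier Y) (carrier Z))
    (g : hom (carrier X) (carrier Y)) :
  is_alg_hom f -> is_alg_hom g -> @is_alg_hom X Z (f ∘ g).
Proof.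
rewrite /is_alg_hom => hf hg.
by rewrite fmap_comp -mcompA hg mcompA hf -mcompA.
Qed.

Definition alg_id X : alg_hom X X := exist _ (idm (carrier X)) (is_alg_hom_id X).

Definition alg_comp X Y Z (f : alg_hom Y Z) (g : alg_hom X Y) : alg_hom X Z :=
  exist _ (sval f ∘ sval g) (is_alg_hom_comp (svalP f) (svalP g)).

Lemma alg_homP X Y (f g : alg_hom X Y) : sval f = sval g -> f = g.
Proof.
case: f g => [f hf] [g hg] /= fg; case: g / fg hg => hg.
by rewrite (Prop_irrelevance hf hg).
Qed.

Lemma alg_compA X Y Z U (f : alg_hom Z U) (g : alg_hom Y Z) (h : alg_hom X Y) :
  alg_comp f (alg_comp g h) = alg_comp (alg_comp f g) h.
Proof. exact/alg_homP/mcompA. Qed.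

Lemma alg_comp1m X Y (f : alg_hom X Y) : alg_comp (alg_id Y) f = f.
Proof. exact/alg_homP/mcomp1m. Qed.

Lemma alg_compm1 X Y (f : alg_hom X Y) : alg_comp f (alg_id X) = f.
Proof. exact/alg_homP/mcompm1. Qed.

Definition algebra_category : category :=
  Category alg_compA alg_comp1m alg_compm1.
End AlgebraCategory.

Definition full_subcategory (D : category) (P : D -> Prop) : category :=
  @Category {X : D | P X} (fun X Y => hom (sval X) (sval Y))
    (fun X => idm (sval X)) (fun X Y Z f g => f ∘ g)
    (fun X Y Z U f g h => mcompA f g h)
    (fun X Y f => mcomp1m f) (fun X Y f => mcompm1 f).

Definition algebra_subcategory (C : category) (T : functor C C)
    (P : algebra T -> Prop) : category :=
  @full_subcategory (algebra_category T) P.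

Definition dual_Ramsey (C : category) : Prop :=
  forall k : nat, 2 <= k -> forall A B : C, exists D : C,
  forall chi : hom D A -> 'I_k, exists w : hom D B,
    chi @` [set f ∘ w | f in [set: hom B A]] #<= `I_1.

(* Main.v *)
Require Import Defs.
From mathcomp Require Import all_boot.
From mathcomp Require Import classical_sets cardinality.

Local Open Scope classical_set_scope.
Local Open Scope card_scope.

(** A morphism [g : D -> A] into the carrier of a weak Eilenberg-Moore algebra
    [(A, alpha)] still induces the homomorphism [alpha . T g : T D -> A] out of
    the free algebra on [D] that the free-forgetful adjunction would assign to
    it if [mu] had a unit ([free_transpose_is_alg_hom]).  Without a unit this
    assignment need not be a bijection from [hom D A] to the homomorphisms
    [T D -> A], but it commutes with postcomposition by homomorphisms
    ([comp_free_transpose]), and that suffices to transport colorings.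

    Indeed, given weak Eilenberg-Moore algebras on [A] and [B], let [D] witness
    the dual Ramsey property of [C] for the carriers [A] and [B].  A coloring of
    the homomorphisms [T D -> A] pulls back along transposition to a coloring of
    [hom D A]; the latter is constant on [hom B A . w] for some [w : D -> B].
    For a homomorphism [f : B -> A], composing [f] with the transpose of [w]
    gives the transpose of [f . w], so the transpose of [w] is as desired for
    the original coloring, and the free algebra on [D] witnesses the dual Ramsey
    property for algebras. *)

Section FreeTranspose.
Variables (C : category) (T : functor C C) (mu : multiplication T).

Definition free_transpose (D : C) (X : algebra T) (g : hom D (carrier X)) :
    hom (T D) (carrier X) :=
  structure X ∘ fmap T g.

(** Naturality of [mu] moves the multiplication past [g], where the weak
    Eilenberg-Moore law trades it for a second copy of the structure map. *)
Lemma free_transpose_is_alg_hom (D : C) (X : algebra T)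
    (g : hom D (carrier X)) :
  weak_EM mu X -> @is_alg_hom C T (free_EM mu D) X (free_transpose D X g).
Proof.
rewrite /is_alg_hom /free_transpose /= => emX.
rewrite -mcompA -(naturality mu g) /= mcompA -emX.
by rewrite fmap_comp !mcompA.
Qed.

Lemma comp_free_transpose (D : C) (X Y : algebra T)
    (f : hom (carrier X) (carrier Y)) (g : hom D (carrier X)) :
  is_alg_hom f ->
  f ∘ free_transpose D X g = free_transpose D Y (f ∘ g).
Proof.
by rewrite /is_alg_hom /free_transpose => hf; rewrite mcompA hf fmap_comp mcompA.
Qed.

End FreeTranspose.

(* The objects of the category W are the algebras satisfying [P]; those of the
   full subcategory of W are selected by [S]. *)
Theorem theorem3p15 (C : category) (T : functor C C) (mu : multiplication T)
    (P : algebra T -> Prop)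
    (P_weak_EM : forall X : algebra T, P X -> weak_EM mu X)
    (S : algebra_subcategory P -> Prop)
    (S_free : forall A : C, exists X : algebra_subcategory P,
        S X /\ proj1_sig X = free_EM mu A) :
  dual_Ramsey C -> dual_Ramsey (full_subcategory S).
Proof.
move=> ramseyC k k_ge2 [[A PA] SA] [[B PB] SB].
have [D ramseyD] := ramseyC k k_ge2 (carrier A) (carrier B).
have [[F PF] [SF /= eqF]] := S_free D; subst F.
exists (exist _ (exist _ (free_EM mu D) PF) SF) => /= chi.
pose transpose (X : algebra T) (PX : P X) (g : hom D (carrier X)) :
    alg_hom (free_EM mu D) X :=
  exist _ _ (free_transpose_is_alg_hom C T mu D X g (P_weak_EM X PX)).
have [w chi_w] := ramseyD (fun g => chi (transpose A PA g)).
exists (transpose B PB w).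
apply: card_le_trans chi_w; apply: subset_card_le.
move=> _ [_ [f _ <-] <-].
exists (sval f ∘ w); first by exists (sval f).
congr chi; apply: alg_homP => /=.
by rewrite comp_free_transpose //; exact: (svalP f).
Qed.
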